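(* Let $n \ge 3$ be an integer. For any $i \in \{1,\ldots,\lfloor n/2\rfloor\}$, the vertex connectivity of the graph $\overline{L_i(n)}'$ is equal to $k-1$, where $k$ is its valency.
   Context: Graphs are finite, undirected, without loops and multiple edges; $\overline{\Gamma}$ denotes the complement of a graph $\Gamma$. The vertex connectivity $\kappa(\Gamma)$ of a graph $\Gamma$ is the minimum number of vertices whose deletion from $\Gamma$ disconnects it. For $n \ge 3$, the $(n\times n)$-lattice graph $L(n)$ has as vertices all ordered pairs of elements from $\{1,\ldots,n\}$, two vertices being adjacent whenever the Hamming distance between the pairs equals $1$. Thus in $\overline{L(n)}$ two vertices $(a,b)$ and $(c,d)$ are adjacent exactly when $a \ne c$ and $b \ne d$. The $m$th row is the set $\{(m,j) \mid j \in \{1,\ldots,n\}\}$. For $i \in \{1,\ldots,\lfloor n/2\rfloor\}$, the $i$-automorphism is the involutive automorphism $\phi$ of $\overline{L(n)}$ that swaps the rows in each of the first $i$ pairs of rows (the $1$st and $2$nd, the $3$rd and $4$th, ..., the $(2i-1)$th and $(2i)$th), i.e. it swaps $(2j-1,z)$ and $(2j,z)$ for all $j \in \{1,\ldots,i\}$ and $z \in \{1,\ldots,n\}$, and fixes all other vertices. It interchanges only non-adjacent vertices of $\overline{L(n)}$. Let $M$ be the adjacency matrix of $\overline{L(n)}$ and $P$ the permutation matrix representing $\phi$. The graph $\overline{L_i(n)}'$ is the graph on the same vertex set with adjacency matrix $PM$ (this is a symmetric $0/1$ matrix with zero diagonal). Equivalently, the neighbourhood of a vertex $x$ in $\overline{L_i(n)}'$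 is the neighbourhood of $\phi(x)$ in $\overline{L(n)}$. The graph $\overline{L_i(n)}'$ is regular. *)

(* Defs.v *)
From mathcomp Require Import all_boot all_order all_algebra.
Set Implicit Arguments.
Unset Strict Implicit.
Unset Printing Implicit Defensive.
Import GRing.Theory.
Local Open Scope ring_scope.

(* A graph on a finite vertex type [T] is a symmetric irreflexive [e : rel T]. *)
Section Graphs.

Variable T : finType.
Implicit Types (e : rel T) (S : {set T}).

Definition graph_compl e : rel T := [rel x y | (x != y) && ~~ e x y].

Definition nbhd e (x : T) : {set T} := [set y | e x y].

Definition regular_of_valency e (k : nat) : Prop := forall x, #|nbhd e x| = k.

Definition delete_vertices e S : rel T :=
  [rel x y | [&& x \notin S, y \notin S & e x y]].

Definition disconnects e S : bool :=
  [exists x, exists y, [&& x \notin S, y \notin S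
                         & ~~ connect (delete_vertices e S) x y]].

(* The default value of the minimum is reached only if no vertex set
   disconnects the graph, that is, if the graph is complete; it follows the
   usual convention that the complete graph on m vertices has connectivity
   m - 1.  In all other cases some set of at most #|T| - 2 vertices
   disconnects. *)
Definition vertex_connectivity e : nat :=
  \big[minn/#|T|.-1]_(S : {set T} | disconnects e S) #|S|.

(* Rows and columns are indexed by the vertices through [enum_val]. *)
Definition adjacency_mx e : 'M[int]_#|T| :=
  \matrix_(x, y) (e (enum_val x) (enum_val y))%:R.

Definition map_perm_mx (f : T -> T) : 'M[int]_#|T| :=
  \matrix_(x, y) (f (enum_val x) == enum_val y)%:R.

Definition graph_of_mx (A : 'M[int]_#|T|) : rel T :=
  [rel x y | A (enum_rank x) (enum_rank y) == 1].

End Graphs.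

Definition vertex (n : nat) : finType := ('I_n * 'I_n)%type.

Definition hamming_dist (n : nat) (u v : vertex n) : nat :=
  ((u.1 != v.1) + (u.2 != v.2))%N.

Definition lattice_graph (n : nat) : rel (vertex n) :=
  [rel u v | hamming_dist u v == 1%N].

Definition lattice_compl (n : nat) : rel (vertex n) :=
  graph_compl (@lattice_graph n).

(* Rows are numbered from 0, so that the j-th pair of rows is
   {2j - 2, 2j - 1} and the first i pairs are the rows r < 2i. *)
Definition swap_row_nat (i r : nat) : nat :=
  if (r < i.*2)%N then (if odd r then r.-1 else r.+1) else r.

(* The default case of [insubd] is never used when 2i <= n. *)
Definition swap_row (n i : nat) (r : 'I_n) : 'I_n :=
  insubd r (swap_row_nat i r).

Definition i_automorphism (n i : nat) (v : vertex n) : vertex n :=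
  (swap_row i v.1, v.2).

Definition switched_mx (n i : nat) : 'M[int]_#|vertex n| :=
  map_perm_mx (@i_automorphism n i) *m adjacency_mx (@lattice_compl n).

Definition switched_graph (n i : nat) : rel (vertex n) :=
  graph_of_mx (switched_mx n i).

Lemma lattice_complE n (u v : vertex n) :
  lattice_compl u v = (u.1 != v.1) && (u.2 != v.2).
Proof.
case: u v => [a b] [c d]; rewrite /lattice_compl /lattice_graph /graph_compl /=.
by rewrite /hamming_dist xpair_eqE /=; do 2 case: (_ == _).
Qed.

Lemma lattice_compl_sym n : symmetric (@lattice_compl n).
Proof. by move=> u v; rewrite !lattice_complE (eq_sym u.1) (eq_sym u.2). Qed.

Lemma swap_row_natK i : involutive (swap_row_nat i).
Proof.
move=> r; rewrite /swap_row_nat; case: (ltnP r i.*2) => lt_ri; last first.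
  by rewrite ltnNge lt_ri.
have [odd_r | even_r] := boolP (odd r).
  case: r odd_r lt_ri => //= r even_r lt_ri.
  by rewrite (ltnW lt_ri) (negbTE even_r).
have -> : (r.+1 < i.*2)%N.
  rewrite ltn_neqAle lt_ri andbT; apply: contraNneq even_r => eq_ri.
  by have := congr1 odd eq_ri; rewrite odd_double /= => /negbFE.
by rewrite /= even_r.
Qed.

Lemma swap_row_lt n i (r : 'I_n) : (i <= n./2)%N -> (swap_row_nat i r < n)%N.
Proof.
move=> le_in; rewrite /swap_row_nat; case: (ltnP r i.*2) => // lt_ri.
have [odd_r | even_r] := boolP (odd r).
  by apply: leq_ltn_trans (ltn_ord r); apply: leq_pred.
have lt_r1 : (r.+1 < i.*2)%N.
  rewrite ltn_neqAle lt_ri andbT; apply: contraNneq even_r => eq_ri.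
  by have := congr1 odd eq_ri; rewrite odd_double /= => /negbFE.
apply: leq_trans lt_r1 _; apply: leq_trans (_ : n./2.*2 <= n)%N.
  by rewrite leq_double.
by rewrite -[leqRHS]odd_double_half leq_addl.
Qed.

Lemma val_swap_row n i (r : 'I_n) :
  (i <= n./2)%N -> swap_row i r = swap_row_nat i r :> nat.
Proof. by move=> le_in; rewrite /swap_row val_insubd swap_row_lt. Qed.

Lemma i_automorphismK n i :
  (i <= n./2)%N -> involutive (@i_automorphism n i).
Proof.
move=> le_in [a b]; congr (_, _); apply: val_inj => /=.
by rewrite !val_swap_row // swap_row_natK.
Qed.

Lemma i_automorphismP n i (u v : vertex n) : (i <= n./2)%N ->
  lattice_compl (i_automorphism i u) (i_automorphism i v) = lattice_compl u v.
Proof.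
move=> le_in; rewrite !lattice_complE /=; congr (~~ _ && _).
apply/eqP/eqP => [/(congr1 val) /= | -> //].
rewrite !val_swap_row // => /(can_inj (@swap_row_natK i)).
exact: val_inj.
Qed.

Lemma switched_mxE n i (u v : vertex n) :
  switched_mx n i (enum_rank u) (enum_rank v)
    = (lattice_compl (i_automorphism i u) v)%:R.
Proof.
rewrite mxE (bigD1 (enum_rank (i_automorphism i u))) //= !mxE !enum_rankK eqxx.
rewrite mul1r big1 ?addr0 // => w ne_w; rewrite !mxE enum_rankK.
case: eqP => [eq_w | _]; last by rewrite mul0r.
by rewrite eq_w enum_valK eqxx in ne_w.
Qed.

Lemma switched_graphE n i (u v : vertex n) :
  switched_graph i u v = lattice_compl (i_automorphism i u) v.
Proof.
change (switched_graph i u v)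
  with (switched_mx n i (enum_rank u) (enum_rank v) == 1).
by rewrite switched_mxE; case: lattice_compl.
Qed.

Lemma adjacency_switched_graph n i :
  adjacency_mx (@switched_graph n i) = switched_mx n i.
Proof.
apply/matrixP => x y; rewrite mxE switched_graphE.
by rewrite -[in RHS](enum_valK x) -[in RHS](enum_valK y) switched_mxE.
Qed.

Lemma switched_graph_sym n i :
  (i <= n./2)%N -> symmetric (@switched_graph n i).
Proof.
move=> le_in u v; rewrite !switched_graphE lattice_compl_sym.
by rewrite -(i_automorphismP _ _ le_in) i_automorphismK.
Qed.

Lemma switched_graph_irrefl n i : irreflexive (@switched_graph n i).
Proof. by move=> u; rewrite switched_graphE lattice_complE /= eqxx andbF. Qed.

(* Main.v *)
Require Import Defs.
From mathcomp Require Import all_boot all_order all_algebra.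
From mathcomp Require Import zify.

Set Implicit Arguments.
Unset Strict Implicit.
Unset Printing Implicit Defensive.

(** The valency is (n - 1)^2.  Deleting all rows but the first two leaves
    two rows that are interchanged by the automorphism phi, and no edge joins
    them; this removes n (n - 2) = (n - 1)^2 - 1 vertices.  Conversely, if a
    set S disconnects the graph, split the remaining vertices into two nonempty
    parts X and Y without edges in between.  Then every vertex of phi(X) shares
    a row or a column with every vertex of Y, which forces
    #|X| + #|Y| <= 2n, and so #|S| >= n^2 - 2n: a cross (the union of a row and
    a column) has 2n - 1 vertices, and two distinct crosses have at most n
    common vertices. *)

Lemma bigminn_leq (I : finType) (P : pred I) (F : I -> nat) (d : nat) (j : I) :
  P j -> \big[minn/d]_(i | P i) F i <= F j.
Proof.
move=> Pj; rewrite unlock; have := mem_index_enum j.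
elim: (index_enum I) => //= k s IHs; rewrite inE => /predU1P[<- | /IHs le_s].
  by rewrite Pj geq_minl.
by case: (P k) => //; apply: leq_trans (geq_minr _ _) le_s.
Qed.

Section Cross.

Variable n : nat.
Implicit Types (u v : vertex n) (X Y : {set vertex n}).

Definition cross u : {set vertex n} :=
  [set v | (v.1 == u.1) || (v.2 == u.2)].

Lemma mem_crossC u v : (u \in cross v) = (v \in cross u).
Proof. by rewrite !inE (eq_sym u.1) (eq_sym u.2). Qed.

(** The row and the column of [u] have [n] vertices each and share [u], hence the strict bound. *)
Lemma card_cross u : #|cross u| < n.*2.
Proof.
have -> : cross u = setX [set u.1] setT :|: setX setT [set u.2].
  by apply/setP=> v; rewrite !inE andbT.
rewrite cardsU !cardsX !cards1 !cardsT !card_ord mul1n muln1 addnn.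
have n_gt0 : 0 < n := leq_ltn_trans (leq0n _) (ltn_ord u.1).
have: 0 < #|setX [set u.1] setT :&: setX setT [set u.2]|.
  by apply/card_gt0P; exists u; rewrite !inE !eqxx.
by rewrite ltn_subrL double_gt0 n_gt0 => ->.
Qed.

(** Centres in a common row or column share just that line; otherwise the crosses meet only in the
    two opposite corners of the rectangle spanned by [u] and [v]. *)
Lemma card_cross2 u v : 1 < n -> u != v -> #|cross u :&: cross v| <= n.
Proof.
move=> n_gt1; rewrite -pair_eqE /= negb_and.
have [eq1 /= ne2 | ne1 _] := eqVneq u.1 v.1.
  have /subset_leq_card : cross u :&: cross v \subset setX [set u.1] setT.
    apply/subsetP=> w; rewrite !inE -eq1 andbT.
    by case: eqP => //= _ /andP[/eqP->]; rewrite (negbTE ne2).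
  by rewrite cardsX cards1 cardsT card_ord mul1n.
have [eq2 | ne2] := eqVneq u.2 v.2.
  have /subset_leq_card : cross u :&: cross v \subset setX setT [set u.2].
    apply/subsetP=> w; rewrite !inE -eq2 /= orbC.
    by case: eqP => //= _ /andP[/eqP->]; rewrite orbF (negbTE ne1).
  by rewrite cardsX cards1 cardsT card_ord muln1.
have /subset_leq_card : cross u :&: cross v \subset
    [set (u.1, v.2); (v.1, u.2)].
  apply/subsetP=> -[a b]; rewrite !inE /= !xpair_eqE.
  case/andP=> /orP[]/eqP-> /orP[]; rewrite ?(negbTE ne1) ?(negbTE ne2) //.
    by move/eqP->; rewrite !eqxx.
  by move/eqP->; rewrite !eqxx orbT.
by move/leq_trans; apply; rewrite cards2; case: (_ != _) => //; apply: ltnW.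
Qed.

(** Two distinct points on one side confine the other side to two crosses, so to at most [n]
    vertices; a singleton confines it to one cross, so to fewer than [2n]. *)
Lemma card_cross_intersecting X Y : 1 < n -> X != set0 -> Y != set0 ->
  {in X & Y, forall u v, v \in cross u} -> #|X| + #|Y| <= n.*2.
Proof.
move=> n_gt1 /set0Pn[x Xx] /set0Pn[y Yy] XY.
have YX : {in Y & X, forall u v, v \in cross u}.
  by move=> u v Yu Xv; rewrite mem_crossC XY.
have sub1 (A B : {set vertex n}) u : u \in A -> {in A & B, forall u v, v \in cross u} ->
    #|B| < n.*2.
  move=> Au AB; apply: leq_ltn_trans (card_cross u); apply: subset_leq_card.
  by apply/subsetP=> v; apply: AB.
have sub2 (A B : {set vertex n}) : 1 < #|A| -> {in A & B, forall u v, v \in cross u} ->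
    #|B| <= n.
  case/card_gt1P=> u [v [Au Av ne_uv]] AB.
  apply: leq_trans (card_cross2 n_gt1 ne_uv); apply: subset_leq_card.
  by apply/subsetP=> w Bw; rewrite inE !AB.
have ltX := sub1 _ _ _ Yy YX; have ltY := sub1 _ _ _ Xx XY.
case: (ltnP 1 #|X|) => [/sub2/(_ XY) leY | ]; last by lia.
case: (ltnP 1 #|Y|) => [/sub2/(_ YX) leX | ]; last by lia.
by lia.
Qed.

End Cross.

Section SwitchedGraph.

Variables n i : nat.
Hypothesis le_in : i <= n./2.

Lemma switched_graph_regular :
  regular_of_valency (@switched_graph n i) (n.-1 * n.-1).
Proof.
move=> u.
have -> : nbhd (@switched_graph n i) u
    = setX (~: [set swap_row i u.1]) (~: [set u.2]).
  apply/setP=> v; rewrite !inE switched_graphE lattice_complE /=.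
  by rewrite (eq_sym v.1) (eq_sym v.2).
by rewrite cardsX !cardsC1 card_ord.
Qed.

Lemma card_disconnects_switched (S : {set vertex n}) : 1 < n ->
  disconnects (@switched_graph n i) S -> n * n <= #|S| + n.*2.
Proof.
move=> n_gt1 /existsP[x /existsP[y /and3P[xS yS not_xy]]].
set e := delete_vertices _ S in not_xy.
pose X := ~: S :&: [set z | connect e x z]; pose Y := ~: S :\: X.
have Xx : x \in X by rewrite !inE xS connect0.
have Yy : y \in Y by rewrite !inE yS not_xy.
have phiK := i_automorphismK le_in.
(* Passing to the image of [X] turns non-adjacency in the switched graph into the cross
   condition. *)
have: #|@i_automorphism n i @: X| + #|Y| <= n.*2.
  apply: card_cross_intersecting => //.
  - by apply/set0Pn; exists (i_automorphism i x); apply: imset_f.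
  - by apply/set0Pn; exists y.
  move=> _ v /imsetP[u Xu ->] Yv.
  (* A vertex [v] outside this cross is adjacent to [u]; unless deleted, it is then reachable from
     [x] and so not in [Y]. *)
  apply: contraLR Yv => v_cross; rewrite !inE.
  move: Xu; rewrite !inE => /andP[uS xu].
  case vS: (v \in S) => //=; rewrite andbT negbK.
  apply: connect_trans xu (connect1 _); rewrite /e /delete_vertices /= uS vS /=.
  rewrite switched_graphE lattice_complE.
  by move: v_cross; rewrite !inE negb_or (eq_sym v.1) (eq_sym v.2).
rewrite card_imset; last exact: can_inj phiK.
have := cardsID X (~: S); have -> : ~: S :&: X = X.
  by rewrite setIA setIid.
have := cardsC S; rewrite card_prod card_ord.
by rewrite -/Y; lia.
Qed.

Lemma disconnects_rows (r : 'I_n) : i.*2 > r ->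
  disconnects (@switched_graph n i) (setX (~: [set r; swap_row i r]) setT).
Proof.
move=> lt_ri; set s := swap_row i r; set S := setX _ _.
have sK : swap_row i s = r.
  by apply: val_inj; rewrite /= !val_swap_row // swap_row_natK.
have ne_sr : s != r.
  rewrite -(inj_eq val_inj) /= val_swap_row // /swap_row_nat lt_ri.
  by case: (nat_of_ord r) => // m; case: ifP => _ /=; lia.
(* Only rows [r] and [s] survive, and a vertex of one has no neighbour in the other. *)
have closed_r : closed (delete_vertices (@switched_graph n i) S)
    [pred v : vertex n | v.1 == r].
  move=> u v /= /and3P[]; rewrite !inE !andbT !negbK.
  rewrite switched_graphE lattice_complE /=.
  move=> /orP[]/eqP-> /orP[]/eqP->; rewrite -/s ?sK ?eqxx //.
(* The column is arbitrary; [r] merely serves as an available index. *)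
apply/existsP; exists (r, r); apply/existsP; exists (s, r).
rewrite !inE !eqxx orbT /=; apply/negP=> /(closed_connect closed_r).
by rewrite !inE /= eqxx (negbTE ne_sr).
Qed.

End SwitchedGraph.

Theorem theorem2 (n i : nat) (hn : 3 <= n) (hi : 1 <= i <= n./2) :
  exists k : nat,
    regular_of_valency (@switched_graph n i) k /\
    vertex_connectivity (@switched_graph n i) = k - 1.
Proof.
case/andP: hi => i_gt0 le_in; exists (n.-1 * n.-1).
split; first exact: switched_graph_regular.
apply/eqP; rewrite eqn_leq; apply/andP; split.
  have n_gt0 : 0 < n by lia.
  (* Row 0 lies in the first swapped pair, since [i] is at least 1. *)
  pose r := Ordinal n_gt0.
  have lt_ri : r < i.*2 by rewrite /=; lia.
  apply: leq_trans (bigminn_leq _ _ (disconnects_rows le_in lt_ri)) _.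
  have ne_r : r != swap_row i r.
    by rewrite -(inj_eq val_inj) /= val_swap_row // /swap_row_nat lt_ri.
  have := cardsC [set r; swap_row i r].
  by rewrite cardsX cards2 ne_r cardsT card_ord; nia.
(* The lower bound must also hold for the default value of the minimum, here [n * n - 1]. *)
rewrite /vertex_connectivity; elim/big_ind: _ => [|a b|S].
- by rewrite card_prod card_ord; nia.
- by rewrite leq_min => -> ->.
- by move/(card_disconnects_switched le_in (ltnW hn)); nia.
Qed.
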